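(* Let $(\{f_i\}_{i\in I},\mathbb{T})$ be a general IFS with uniform contraction constant $c\in(0,1)$ on a complete metric space $(X,\rho)$, and for each $i\in I$ let $z_i\in X$ be the unique fixed point of $f_i$. Suppose that there exists $x\in X$ such that $$\sum_{n\in\mathbb{N}}\Big\{\max_{i\in I_n}\rho(x,z_i)\Big\}\cdot c^n<\infty .$$ Then, for each $\omega\in\mathbb{T}$ and each $A\in\mathcal{K}(X)$, the sequence $\{f_{\omega_{[1,n]}}(A)\}_{n\in\mathbb{N}}$ of compact subsets converges to the singleton $\{\pi(\omega)\}$ as $n\to\infty$ with respect to the Hausdorff distance $\rho_H$.
   Context: $\mathbb{N}$ is the set of positive integers. Words. $I$ is a countable set (alphabet) with the discrete topology, and $I^{\mathbb{N}}$ carries the product topology. $\phi$ denotes the empty word. For $\omega=\omega_1\omega_2\cdots\in I^{\mathbb{N}}$, $\omega_{[m,n]}:=\omega_m\cdots\omega_n$. Trees. A tree with $I$ is a non-empty closed subset $\mathbb{T}\subset I^{\mathbb{N}}$ such that $S(\mathbb{T},\phi):=\{\omega_1 : \omega\in\mathbb{T}\}$ is finite and, for each $n\in\mathbb{N}$ and $\omega\in\mathbb{T}$, the set $S(\mathbb{T},\omega_{[1,n]}):=\{\tau_{n+1} : \tau\in\mathbb{T},\ \tau_{[1,n]}=\omega_{[1,n]}\}$ is finite. Put $\mathbb{T}^{[1,n]}:=\{\omega_{[1,n]} : \omega\in\mathbb{T}\}$, $I_1:=S(\mathbb{T},\phi)$ and $I_n:=\bigcup_{\tau\in\mathbb{T}^{[1,n-1]}}S(\mathbb{T},\tau)$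 for $n\ge2$; each $I_n$ is a finite set. General IFS. A general IFS on a complete metric space $(X,\rho)$ with uniform contraction constant $c\in(0,1)$ is a pair $(\{f_i\}_{i\in I},\mathbb{T})$ where $\mathbb{T}$ is a tree with $I$ and $f_i\colon X\to X$ satisfy $\rho(f_i(x),f_i(y))\le c\,\rho(x,y)$ for all $i\in I$, $x,y\in X$. For a word $\omega=\omega_1\cdots\omega_n$, $f_\omega:=f_{\omega_1}\circ\cdots\circ f_{\omega_n}$. Projection map. Under the summability assumption of the claim, for each $\omega\in\mathbb{T}$ there is a unique sequence $\{x_m\}_{m\in\mathbb{N}}$ in $X$ such that $f_{\omega_m}(x_{m+1})=x_m$ for all $m\in\mathbb{N}$ and such that there is $C>0$ with $\rho(y,x_m)\le C\,c^{-m}\sum_{k\ge m}c^k\rho(y,z_{\omega_k})$ for all $y\in X$, $m\in\mathbb{N}$. The projection map $\pi\colon\mathbb{T}\to X$ is $\pi(\omega):=x_1$. $\mathcal{K}(X)$ is the set of non-empty compact subsets of $X$, and $\rho_H$ is the Hausdorff distance on $\mathcal{K}(X)$. *)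

(* Defs.v *)
From HB Require Import structures.
From mathcomp Require Import all_boot all_order all_algebra finmap.
From mathcomp Require Import all_classical all_reals all_analysis.

Set Implicit Arguments.
Unset Strict Implicit.
Unset Printing Implicit Defensive.

Import Order.TTheory GRing.Theory Num.Theory.

Local Open Scope classical_set_scope.
Local Open Scope ring_scope.

(* [Complete] is based on pointed spaces, so these spaces are non-empty. *)
#[short(type="completeMetricType")]
HB.structure Definition CompleteMetric (R : numDomainType) :=
  { X of Complete X & Metric R X }.

Section Words.
Context {I : countType}.

(* Infinite words are indexed from 0: [w n] is the letter $\omega_{n+1}$, and
   [mkseq w n] is the finite word $\omega_{[1,n]}$. *)

(* The letters following the finite word [s] in [T]; [successors T [::]] is
   the set of first letters. *)
Definition successors (T : set (nat -> I)) (s : seq I) : set I :=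
  [set t (size s) | t in [set t | T t /\ mkseq t (size s) = s]].

Definition is_tree (T : set (nat -> I)) : Prop :=
  [/\ T !=set0,
      closed (T : set {ptws nat -> discrete_topology I}),
      finite_set (successors T [::]) &
      forall (n : nat) (w : nat -> I), T w ->
        finite_set (successors T (mkseq w n.+1))].

Definition initial_words (T : set (nat -> I)) (n : nat) : set (seq I) :=
  [set mkseq w n | w in T].

(* [level T n] is the alphabet $I_{n+1}$ of the letters at position [n]. *)
Definition level (T : set (nat -> I)) (n : nat) : set I :=
  if n is 0 then successors T [::]
  else \bigcup_(s in initial_words T n) successors T s.

End Words.

Section GeneralIFS.
Context {R : realType} {X : completeMetricType R} {I : countType}.

Definition is_general_IFS (c : R) (f : I -> X -> X) (T : set (nat -> I)) :
    Prop :=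
  is_tree T /\
  forall (i : I) (x y : X), mdist (f i x) (f i y) <= c * mdist x y.

Definition word_map (f : I -> X -> X) (s : seq I) : X -> X :=
  foldr (fun i g => f i \o g) id s.

(* $\max_{i \in I_{n+1}} \rho(x, z_i)$; the levels of a tree are finite, so
   [fset_set] enumerates them. *)
Definition level_maxdist (T : set (nat -> I)) (z : I -> X) (x : X) (n : nat) :
    R :=
  \big[Num.max/0]_(i <- fset_set (level T n)) mdist x (z i).

(* [xs m] is $x_{m+1}$, whence the shifted exponents. *)
Definition is_projection_seq (c : R) (f : I -> X -> X) (z : I -> X)
    (w : nat -> I) (xs : nat -> X) : Prop :=
  (forall m, f (w m) (xs m.+1) = xs m) /\
  exists2 C : R, 0 < C &
    forall (y : X) (m : nat),
      ((mdist y (xs m))%:E <=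
       (C * c ^- m.+1)%:E *
       \sum_(m <= k <oo) (c ^+ k.+1 * mdist y (z (w k)))%:E)%E.

Definition projection (c : R) (f : I -> X -> X) (z : I -> X) (w : nat -> I) :
    X :=
  xget (fun=> point) [set xs | is_projection_seq c f z w xs] 0%N.

End GeneralIFS.

Section Hausdorff.
Context {R : realType} {X : metricType R}.

Definition nonempty_compacts : set (set X) :=
  [set A | A !=set0 /\ compact A].

(* Extended-real valued so that it is meaningful on all subsets; it is finite
   on [nonempty_compacts]. *)
Definition hausdorff_dist (A B : set X) : \bar R :=
  maxe (ereal_sup [set ereal_inf [set (mdist a b)%:E | b in B] | a in A])
       (ereal_sup [set ereal_inf [set (mdist a b)%:E | a in A] | b in B]).

End Hausdorff.

(* Main.v *)
Require Import Defs.
From mathcomp Require Import all_boot all_order all_algebra.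
From mathcomp Require Import all_classical all_reals all_analysis.

Local Open Scope classical_set_scope.
Local Open Scope ring_scope.

Import Order.TTheory GRing.Theory Num.Theory.
Import metricType_numDomainType.

(** Write [u_{m,n}(y)] for the image of [y] under the composite of the maps
    indexed by the letters [w m, ..., w (m + n - 1)].  Since [z_i] is fixed by
    [f_i], the map [f_i] moves a point [y] by at most
    [(1 + c) * mdist y z_i]; appending one more letter to a composite of [n]
    contractions therefore moves [u_{m,n}(y)] by at most
    [c ^ n * (1 + c) * mdist y z_(w (m + n))].  Summed over [n], the total
    displacement of [y] is at most [(1 + c) * c ^ - (m + 1)] times the tail
    from [m] of the series of general term
    [c ^ (k + 1) * mdist y z_(w k)] ([displacement_le_tail_sum]).

    At the point [x] of the summability assumption this series converges:
    each level of the tree is finite, so the letter [w k] takes part in the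
    maximum over its level ([le_level_maxdist]).  Its tails tend to [0], hence
    [u_{m,n}(x)] is a Cauchy sequence in [n]; its limits [x_m] do not depend on
    the starting point, and form a sequence of the kind that defines the
    projection
    ([lim_factor_map_projection_seq]).

    The conclusion uses only the two defining properties of such a sequence.
    The first gives [x_0 = u_{0,n}(x_n)], so that [u_{0,n}(a)] is within
    [c ^ n * mdist a x_n] of [x_0].  The second bounds [mdist a x_n] by
    a constant times [c ^ - (n + 1)] times the tail at [n] of the series of
    [a].  The powers of [c] cancel up to a constant and a tail of a series
    remains ([projection_seq_dist]).  On a compact set [mdist a x] is bounded
    by some [M], and all these series are dominated by that of general term
    [c ^ (k + 1) * (M + mdist x z_(w k))], so the convergence is uniform in
    [a], which is convergence in the Hausdorff distance to a singleton. *)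

(** * Levels of a tree *)

(** The axioms of a tree only assert finite branching at each word.  Finiteness of
    the words of length [n] and of the letters at position [n] have to be
    proved together, as a word of length [n.+1] is a word of length [n]
    followed by a letter of level [n]. *)
Lemma initial_words_level_finite (I : countType) (T : set (nat -> I))
    (n : nat) :
  is_tree T -> finite_set (initial_words T n) /\ finite_set (level T n).
Proof.
move=> [_ _ fin0 finS]; elim: n => [|n [finW finL]].
  split => //; apply: (@sub_finite_set _ _ [set [::]]) => // s [w _ <-] //.
have fin : finite_set (initial_words T n.+1).
  apply: (@sub_finite_set _ _
    (\bigcup_(s in initial_words T n) [set rcons s i | i in level T n])).
    move=> _ [w Tw <-]; exists (mkseq w n); first by exists w.
    exists (w n); last by rewrite /mkseq -addn1 iotaD map_cat cats1.
    case: n {finW finL} => [|n] /=; first by exists w.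
    exists (mkseq w n.+1); first by exists w.
    by exists w; rewrite ?size_mkseq.
  by apply: bigcup_finite => // s _; exact: finite_image.
split=> //; apply: bigcup_finite => // _ [w Tw <-].
exact: finS.
Qed.

Lemma level_letter (I : countType) (T : set (nat -> I)) (w : nat -> I)
    (n : nat) : T w -> level T n (w n).
Proof.
move=> Tw; case: n => [|n] /=; first by exists w.
by exists (mkseq w n.+1); exists w; rewrite ?size_mkseq.
Qed.

Lemma le_level_maxdist (R : realType) (X : completeMetricType R)
    (I : countType) (T : set (nat -> I)) (z : I -> X) (x : X) (w : nat -> I)
    (n : nat) :
  is_tree T -> T w -> mdist x (z (w n)) <= level_maxdist T z x n.
Proof.
move=> /(initial_words_level_finite _ _ n)[_ finL] Tw.
apply: (le_bigmax_seq 0 (w n) xpredT (fun i => mdist x (z i))) => //.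
by rewrite in_fset_set // inE; exact: level_letter.
Qed.

(** * Compositions along an infinite word *)

Section GeneralIFS.
Set Implicit Arguments.
Unset Strict Implicit.
Context (R : realType) (X : completeMetricType R) (I : countType).
Context (c : R) (f : I -> X -> X) (z : I -> X) (w : nat -> I).
Hypothesis c01 : 0 < c < 1.
Hypothesis contr : forall (i : I) (x y : X),
  mdist (f i x) (f i y) <= c * mdist x y.
Hypothesis fixz : forall i : I, f i (z i) = z i.

Let c_gt0 : 0 < c. Proof. by case/andP: c01. Qed.
Let c_ge0 : 0 <= c. Proof. exact: ltW. Qed.

Definition factor_map (m n : nat) : X -> X :=
  word_map f [seq w k | k <- iota m n].

Definition tail_sum (y : X) (m : nat) : \bar R :=
  (\sum_(m <= k <oo) (c ^+ k.+1 * mdist y (z (w k)))%:E)%E.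

Lemma word_map_cat (s t : seq I) (x : X) :
  word_map f (s ++ t) x = word_map f s (word_map f t x).
Proof. by elim: s => //= i s ->. Qed.

Lemma factor_mapD (m n k : nat) (x : X) :
  factor_map m (n + k) x = factor_map m n (factor_map (m + n) k x).
Proof. by rewrite /factor_map iotaD map_cat word_map_cat. Qed.

Lemma word_map_contraction (s : seq I) (x y : X) :
  mdist (word_map f s x) (word_map f s y) <= c ^+ size s * mdist x y.
Proof.
elim: s => [|i s IH] /=; first by rewrite expr0 mul1r.
by apply: le_trans (contr _ _ _) _; rewrite exprS -mulrA ler_wpM2l.
Qed.

Lemma factor_map_contraction (m n : nat) (x y : X) :
  mdist (factor_map m n x) (factor_map m n y) <= c ^+ n * mdist x y.
Proof.
by apply: le_trans (word_map_contraction _ _ _) _; rewrite size_map size_iota.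
Qed.

(** Go through the fixed point: [y] is moved to within [c * mdist y (z i)] of
    [z i]. *)
Lemma displacement_le (i : I) (y : X) :
  mdist y (f i y) <= (1 + c) * mdist y (z i).
Proof.
apply: le_trans (metric_triangle _ (z i) _) _.
rewrite mulrDl mul1r lerD2l -{1}(fixz i) (metric_sym y).
exact: contr.
Qed.

(** The composite is extended on the inside, so the new displacement is that
    of a single map, shrunk by the [n] contractions around it.  The factor
    [c ^+ m.+1] turns the powers of [c] relative to [m] into those of the
    series of [y]. *)
Lemma scaled_displacement_le_sum (y : X) (m n : nat) :
  c ^+ m.+1 * mdist y (factor_map m n y) <=
  (1 + c) * \sum_(m <= k < m + n) c ^+ k.+1 * mdist y (z (w k)).
Proof.
elim: n => [|n IH].
  by rewrite addn0 big_geq // /factor_map /= mdistxx !mulr0.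
rewrite addnS big_nat_recr ?leq_addr //= mulrDr -(addn1 n) factor_mapD.
apply: le_trans (lerD IH (lexx _)).
apply: (@le_trans _ _ (c ^+ m.+1 * (mdist y (factor_map m n y) +
    c ^+ n * ((1 + c) * mdist y (z (w (m + n)%N)))))).
  rewrite ler_pM2l ?exprn_gt0 //.
  apply: le_trans (metric_triangle _ (factor_map m n y) _) _.
  rewrite lerD2l; apply: le_trans (factor_map_contraction _ _ _ _) _.
  by rewrite ler_pM2l ?exprn_gt0 //; exact: displacement_le.
by rewrite mulrDr lerD2l mulrA -exprD addSn mulrCA.
Qed.

Lemma tail_term_ge0 (y : X) (k : nat) :
  (0 <= (c ^+ k.+1 * mdist y (z (w k)))%:E)%E.
Proof. by rewrite lee_fin mulr_ge0 ?exprn_ge0 ?mdist_ge0. Qed.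

Lemma displacement_le_tail_sum (y : X) (m n : nat) :
  ((mdist y (factor_map m n y))%:E <=
   ((1 + c) * c ^- m.+1)%:E * tail_sum y m)%E.
Proof.
have cm_gt0 : 0 < c ^+ m.+1 by rewrite exprn_gt0.
apply: (@le_trans _ _ (((1 + c) * c ^- m.+1)%:E *
    (\sum_(m <= k < m + n) c ^+ k.+1 * mdist y (z (w k)))%:E)%E).
  by rewrite lee_fin mulrAC ler_pdivlMr // mulrC scaled_displacement_le_sum.
rewrite lee_wpmul2l ?lee_fin ?mulr_ge0 ?addr_ge0 ?invr_ge0 ?(ltW cm_gt0) //.
rewrite -sumEFin.
by apply: (nneseries_lim_ge (P := xpredT)) => k _ _; exact: tail_term_ge0.
Qed.

(** Extending [factor_map m N x] only replaces the innermost point [x] by its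
    displacement along the letters from [m + N] on.  The contraction factor
    [c ^+ N] cancels against the power of [c] in the bound of that
    displacement, which leaves a fixed multiple of the tail at [m + N]. *)
Lemma factor_map_cvg (x : X) (m : nat) :
  (tail_sum x 0 < +oo)%E -> cvg (factor_map m n x @[n --> \oo]).
Proof.
move=> fin; apply: cauchy_cvg; apply: cauchy_exP => e e_gt0.
have tail0 : (((1 + c) * c ^- m.+1)%:E * tail_sum x n @[n --> \oo] --> 0)%E.
  rewrite -(mule0 ((1 + c) * c ^- m.+1)%:E).
  apply: (@cvgeZl _ _ _ (tail_sum x)) => //.
  by apply: (@nneseries_tail_cvg _ _ xpredT) => // k _; exact: tail_term_ge0.
have [N _ HN] : \forall n \near \oo,
    (((1 + c) * c ^- m.+1)%:E * tail_sum x n < e%:E)%E.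
  exact: (tail0 _ (nbhs_open_ereal_lt (f := fun=> e) e_gt0)).
exists (factor_map m N x); exists N => // n /= leNn.
rewrite ballEmdist /= -(subnKC leNn) factor_mapD -lte_fin.
apply: le_lt_trans (HN (m + N)%N (leq_addl _ _)).
apply: (@le_trans _ _ ((c ^+ N)%:E *
    (((1 + c) * c ^- (m + N).+1)%:E * tail_sum x (m + N)))%E).
  apply: (@le_trans _ _
    (c ^+ N * mdist x (factor_map (m + N) (n - N) x))%:E).
    by rewrite lee_fin factor_map_contraction.
  rewrite EFinM lee_wpmul2l ?lee_fin ?exprn_ge0 //.
  exact: displacement_le_tail_sum.
rewrite muleA -EFinM mulrCA -addSn exprD invfM [c ^+ N * _]mulrC.
by rewrite mulfVK // expf_neq0 // gt_eqF.
Qed.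

Lemma factor_map_cvg_indep (x y l : X) (m : nat) :
  factor_map m n x @[n --> \oo] --> l -> factor_map m n y @[n --> \oo] --> l.
Proof.
move=> /cvgrPdist_lt xl; apply/cvgrPdist_lt => e e_gt0.
have e2 : 0 < e / 2 by rewrite divr_gt0.
have geo : geometric (mdist x y) c @ \oo --> 0.
  by apply: cvg_geometric; rewrite gtr0_norm //; case/andP: c01.
have {}geo : \forall n \near \oo, mdist x y * c ^+ n < e / 2.
  exact: (cvgr_lt _ geo).
near=> n.
apply: le_lt_trans (metric_triangle _ (factor_map m n x) _) _.
rewrite (splitr e) ltrD //; first by near: n; exact: xl.
apply: le_lt_trans (factor_map_contraction _ _ _ _) _.
by rewrite mulrC; near: n.
Unshelve. all: by end_near. Qed.

(** The estimate required of a projection sequence is demanded at every point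
    [y], while the series is known to converge only at [x].  As the limits
    may be computed from any starting point, it suffices to pass to the limit
    in the bound of the displacement of [y]; where the series of [y]
    diverges, that bound is infinite and holds trivially. *)
Lemma lim_factor_map_projection_seq (x : X) :
  (tail_sum x 0 < +oo)%E ->
  is_projection_seq c f z w (fun m => lim (factor_map m n x @[n --> \oo])).
Proof.
move=> fin.
have xs_cvg m : factor_map m n x @[n --> \oo] -->
    lim (factor_map m n x @[n --> \oo]) by exact: factor_map_cvg.
split=> [m|].
  have cvg_lhs : factor_map m n.+1 x @[n --> \oo] -->
      f (w m) (lim (factor_map m.+1 n x @[n --> \oo])).
    apply/cvgrPdist_lt => e e_gt0; near=> n.
    apply: le_lt_trans (contr _ _ _) _.
    apply: (@le_lt_trans _ _ (mdist (lim (factor_map m.+1 n x @[n --> \oo]))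
       (factor_map m.+1 n x))).
      by rewrite ler_piMl ?mdist_ge0 // ltW //; case/andP: c01.
    by near: n; have /cvgrPdist_lt := xs_cvg m.+1; exact.
  have cvg_rhs : factor_map m n.+1 x @[n --> \oo] -->
      lim (factor_map m n x @[n --> \oo]).
    by rewrite (cvg_shiftS (fun n => factor_map m n x)).
  exact: (cvg_unique (@metric_hausdorff _ X) cvg_lhs cvg_rhs).
exists (1 + c) => [|y m]; first by rewrite addr_gt0.
have /cvgrPdist_lt ycvg := factor_map_cvg_indep y (xs_cvg m).
apply/lee_addgt0Pr => e e_gt0.
have [n _ /(_ n (leqnn n)) ne] := ycvg e e_gt0.
apply: le_trans (leeD (displacement_le_tail_sum y m n) (lexx _)).
rewrite -EFinD lee_fin.
apply: le_trans (metric_triangle _ (factor_map m n y) _) _.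
by rewrite lerD2l metric_sym ltW.
Unshelve. all: by end_near. Qed.

(** The factor [c ^+ n] gained by applying [n] contractions to [a] and [xs n]
    is what makes up for the diverging [c ^- n.+1] of the second property of a
    projection sequence. *)
Lemma projection_seq_dist (xs : nat -> X) :
  is_projection_seq c f z w xs ->
  exists2 K : R, 0 <= K & forall (a : X) (n : nat),
    ((mdist (word_map f (mkseq w n) a) (xs 0%N))%:E <=
     K%:E * tail_sum a n)%E.
Proof.
move=> [shift [C C_gt0 bound]].
have xs0 n : xs 0%N = factor_map 0 n (xs n).
  by elim: n => // n ->; rewrite -(addn1 n) factor_mapD addn1 -shift.
exists (C / c) => [|a n]; first by rewrite divr_ge0 // ltW.
have cn_gt0 : 0 < c ^+ n by rewrite exprn_gt0.
apply: (@le_trans _ _ ((c ^+ n)%:E * (mdist a (xs n))%:E)%E).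
  by rewrite (xs0 n) -EFinM lee_fin; exact: factor_map_contraction.
apply: (@le_trans _ _
    ((c ^+ n)%:E * ((C * c ^- n.+1)%:E * tail_sum a n))%E).
  by rewrite lee_wpmul2l ?lee_fin ?(ltW cn_gt0) // bound.
rewrite muleA -EFinM exprS invfM mulrCA [c ^+ n * _]mulrC.
by rewrite mulfVK // gt_eqF.
Qed.

End GeneralIFS.

(** * Hausdorff distance and compact sets *)

(** Both one-sided distances to a singleton are controlled by any uniform bound
    on the distances to its point; non-emptiness of [S] is needed for the one
    from [p] to [S], which is an infimum over [S]. *)
Lemma hausdorff_dist_set1 (R : realType) (X : metricType R) (S : set X)
    (p : X) (e : \bar R) :
  S !=set0 -> (forall a, S a -> ((mdist a p)%:E <= e)%E) ->
  (0 <= hausdorff_dist S [set p] <= e)%E.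
Proof.
move=> [a Sa] Se; apply/andP; split.
  rewrite le_max; apply/orP; left.
  apply: le_ereal_sup_tmp; exists (mdist a p)%:E.
    by exists a => //; rewrite image_set1 ereal_inf1.
  by rewrite lee_fin mdist_ge0.
rewrite ge_max; apply/andP; split; apply: ge_ereal_sup.
  move=> _ [b Sb <-]; apply: le_trans (Se b Sb).
  by apply: ereal_inf_lbound; exists p.
move=> _ [_ -> <-]; apply: le_trans (Se a Sa).
by apply: ereal_inf_lbound; exists a.
Qed.

(** Near each point of [A], all large enough [M] bound the distance to [x];
    compactness makes the choice of [M] uniform. *)
Lemma compact_mdist_bounded (R : realType) (X : metricType R) (A : set X)
    (x : X) :
  compact A -> exists2 M : R, 0 <= M & forall a, A a -> mdist x a <= M.
Proof.
move=> /compact_near_coveringP cA.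
have AM : \forall M \near (+oo : set_system R),
    A `<=` (fun a => mdist x a <= M).
  apply: (cA R +oo (fun M a => mdist x a <= M)) => a0 _.
  exists (ball a0 1, [set M | mdist x a0 + 1 <= M]) => [|[a M] /= [+ aM]].
    split; first exact: nbhsx_ballx.
    by apply: nbhs_pinfty_ge; exact: num_real.
  rewrite ballEmdist /= => a0a; apply: le_trans aM.
  by apply: le_trans (metric_triangle _ a0 _) _; rewrite lerD2l ltW.
have [M [M_ge0 {}AM]] := filter_ex (filterI (nbhs_pinfty_ge (real0 R)) AM).
by exists M.
Qed.

(** * Convergence to the projection *)

Theorem proposition4p3 (R : realType) (X : completeMetricType R)
    (I : countType) (c : R) (f : I -> X -> X) (T : set (nat -> I))
    (z : I -> X)
    (c01 : 0 < c < 1)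
    (ifs : is_general_IFS c f T)
    (fixz : forall i : I, unique (fun y : X => f i y = y) (z i))
    (summable : exists x : X,
      (\sum_(0 <= n <oo) (level_maxdist T z x n * c ^+ n.+1)%:E < +oo)%E)
    (w : nat -> I) (Tw : T w)
    (A : set X) (KA : nonempty_compacts A) :
  hausdorff_dist (word_map f (mkseq w n) @` A) [set projection c f z w]
    @[n --> \oo] --> 0%E.
Proof.
case: ifs => tree contr; case: summable => x sumx; case: KA => A0 cA.
have [c_gt0 c_lt1] := andP c01.
have fixed i : f i (z i) = z i by case: (fixz i).
have fin : (tail_sum c z w x 0 < +oo)%E.
  apply: le_lt_trans sumx; rewrite /tail_sum.
  apply: lee_nneseries => [k _ _|k _].
    exact: (tail_term_ge0 z w c01).
  by rewrite lee_fin mulrC ler_pM2r ?exprn_gt0 // le_level_maxdist.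
have [K K_ge0 dist_le] := projection_seq_dist c01 contr
  (xgetPex (fun=> point)
    (ex_intro _ _ (lim_factor_map_projection_seq c01 contr fixed fin))).
have [M M_ge0 AM] := compact_mdist_bounded x cA.
(* The common dominating series for all starting points in [A]. *)
pose b k := (c ^+ k.+1 * M + c ^+ k.+1 * mdist x (z (w k)))%:E.
have b_ge0 k : (0 <= b k)%E.
  by rewrite lee_fin addr_ge0 // mulr_ge0 ?exprn_ge0 ?mdist_ge0 // ltW.
have b_fin : (\sum_(0 <= k <oo) b k < +oo)%E.
  under eq_eseriesr do rewrite /b EFinD.
  rewrite nneseriesD => [|k _ _|k _ _]; last 2 first.
  - by rewrite lee_fin mulr_ge0 ?exprn_ge0 // ltW.
  - exact: (tail_term_ge0 z w c01).
  rewrite lte_add_pinfty //.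
  (* The constant [M] contributes a geometric series of first term [c * M]. *)
  apply: (@le_lt_trans _ _ (c * M * (1 - c)^-1)%:E); last exact: ltry.
  apply: lime_le.
    apply: is_cvg_nneseries => k _ _.
    by rewrite lee_fin mulr_ge0 ?exprn_ge0 // ltW.
  apply: nearW => n; rewrite sumEFin lee_fin.
  apply: le_trans (geometric_le_lim n _ c_gt0 _).
  - rewrite /series /= ler_sum // => k _.
    by rewrite exprS mulrAC.
  - by rewrite mulr_ge0 // ltW.
  - by rewrite gtr0_norm.
pose t n := (\sum_(n <= k <oo) b k)%E.
have t_cvg : (t n @[n --> \oo] --> 0)%E.
  by apply: (@nneseries_tail_cvg _ _ xpredT).
have Kt_cvg : (K%:E * t n @[n --> \oo] --> 0)%E.
  by rewrite -(mule0 K%:E); apply: (@cvgeZl _ _ _ t).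
have sandwich n : (0 <= hausdorff_dist (word_map f (mkseq w n) @` A)
    [set projection c f z w] <= K%:E * t n)%E.
  apply: hausdorff_dist_set1; first exact: image_nonempty.
  move=> _ [a Aa <-]; apply: le_trans (dist_le a n) _.
  rewrite lee_wpmul2l ?lee_fin // /tail_sum.
  apply: lee_nneseries => [k _ _|k _].
    exact: (tail_term_ge0 z w c01).
  rewrite lee_fin -mulrDr ler_pM2l ?exprn_gt0 //.
  apply: le_trans (metric_triangle _ x _) _.
  by rewrite lerD2r metric_sym AM.
apply: (squeeze_cvge _ (cvg_cst 0%E) Kt_cvg).
by apply: nearW => n; exact: sandwich.
Qed.
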